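(* Let $0<\rho<1$ be a non-dyadic number and let $d$ be a positive integer. Then there is a constant $c_{d,\rho}>0$, depending only on $d$ and $\rho$, such that for every $n$ and every polynomial $P\colon\mathbb{F}_2^n\to\mathbb{F}_2$ of degree at most $d$, the distribution of $P(X)$ for $X$ uniform on $\mathbb{F}_2^n$ satisfies $\|P(X)-\mathrm{Ber}(\rho)\|_{\mathtt{TV}}\ge c_{d,\rho}$.
   Context: A dyadic number is one of the form $a/2^b$ with $a\in\mathbb{Z}$, $b\in\mathbb{N}$. Total variation distance: $\frac12\sum_x|\mathcal{D}_1(x)-\mathcal{D}_2(x)|$. *)

(* Defs.v *)
From HB Require Import structures.
From mathcomp Require Import all_boot all_order all_algebra.
From mathcomp Require Import mpoly.
From mathcomp Require Import reals.
Set Implicit Arguments. Unset Strict Implicit. Unset Printing Implicit Defensive.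
Import Order.TTheory GRing.Theory Num.Theory.
Local Open Scope ring_scope.

(* f : F_2^n -> F_2 is (given by) a polynomial of degree at most d:
   some multivariate polynomial over F_2 of total degree <= d evaluates to f.
   (msize p = 1 + total degree of p, and msize 0 = 0.) *)
Definition poly_deg_le (n d : nat) (f : 'rV['F_2]_n -> 'F_2) : Prop :=
  exists p : {mpoly 'F_2[n]},
    (msize p <= d.+1)%N /\ forall x : 'rV['F_2]_n, p.@[fun i => x ord0 i] = f x.

Definition dyadic (R : realType) (r : R) : Prop :=
  exists (a : int) (b : nat), r = a%:~R / 2 ^+ b.

Definition law_unif (R : realType) (n : nat) (P : 'rV['F_2]_n -> 'F_2)
  (y : 'F_2) : R :=
  #|[set x : 'rV['F_2]_n | P x == y]|%:R / (2 ^+ n).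

Definition bernoulli_F2 (R : realType) (rho : R) (y : 'F_2) : R :=
  if y == 1 then rho else 1 - rho.

Definition tv_dist (R : realType) (T : finType) (D1 D2 : T -> R) : R :=
  2^-1 * \sum_(x : T) `|D1 x - D2 x|.

(* Main.v *)
(* Signs phi = (-1)^P of polynomials are studied along sequences of finite
   abelian groups and an ultrafilter. If P has degree at most d+1 and the mean
   beta of phi does not tend to 0, then beta phi(x) = E_h phi(x+h) phi(x) can be
   sampled, so phi is L^1-close to a function psi of boundedly many phases of
   degree d. As the (d+2)-nd derivative of P vanishes, phi(x) is the product of
   phi over the other vertices of any (d+2)-dimensional cube at x; replacing phi
   by psi there and averaging over the cubes gives a function F uniformly close
   to phi. The function F is almost everywhere continuous in the phases of
   degree d (fiber_cont, by induction on d), hence phi, being a sign, agrees in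
   the limit almost everywhere with a function of finitely many phases of degree
   d. The Fourier coefficients of such a function are dyadic, so by induction on
   the degree every limit of means of phases is dyadic. Polynomials violating
   the theorem would make 1 - 2 rho such a limit. *)
Require Import Defs.
From HB Require Import structures.
From mathcomp Require Import all_boot all_order all_algebra.
From mathcomp Require Import mpoly.
From mathcomp Require Import reals.
From mathcomp Require Import boolp classical_sets filter ring lra.
Import Order.TTheory GRing.Theory Num.Theory.
Local Open Scope ring_scope.
Set Implicit Arguments.
Unset Strict Implicit.
Unset Printing Implicit Defensive.

(** * Averages over finite abelian groups *)

HB.instance Definition _ (V W : finZmodType) := Finite.on (V * W)%type.

Section Mean.
Variable R : realType.
Implicit Types V W : finZmodType.

Definition mean V (f : V -> R) : R := #|V|%:R^-1 * \sum_x f x.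

Lemma card_gt0R V : 0 < #|V|%:R :> R.
Proof. by rewrite ltr0n; apply/card_gt0P; exists 0. Qed.

Lemma invcard_ge0 V : 0 <= #|V|%:R^-1 :> R.
Proof. by rewrite invr_ge0 ltW // card_gt0R. Qed.

Lemma eq_mean V (f g : V -> R) : f =1 g -> mean f = mean g.
Proof. by move=> fg; congr (_ * _); apply: eq_bigr => x _. Qed.

Lemma le_mean V (f g : V -> R) : (forall x, f x <= g x) -> mean f <= mean g.
Proof.
move=> fg; apply: ler_wpM2l; first exact: invcard_ge0.
by apply: ler_sum => x _; apply: fg.
Qed.

Lemma mean_cst V (c : R) : mean (fun _ : V => c) = c.
Proof.
rewrite /mean sumr_const -[c *+ _]mulr_natl mulrA mulVf ?mul1r //.
by rewrite gt_eqF ?card_gt0R.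
Qed.

Lemma meanD V (f g : V -> R) : mean (fun x => f x + g x) = mean f + mean g.
Proof. by rewrite /mean big_split mulrDr. Qed.

Lemma meanZ V c (f : V -> R) : mean (fun x => c * f x) = c * mean f.
Proof. by rewrite /mean -mulr_sumr mulrCA. Qed.

Lemma meanB V (f g : V -> R) : mean (fun x => f x - g x) = mean f - mean g.
Proof. by rewrite /mean sumrB mulrBr. Qed.

Lemma mean_ge0 V (f : V -> R) : (forall x, 0 <= f x) -> 0 <= mean f.
Proof. by move=> f0; rewrite -(mean_cst V 0); apply: le_mean. Qed.

Lemma ler_norm_mean V (f : V -> R) : `|mean f| <= mean (fun x => `|f x|).
Proof.
rewrite /mean normrM (ger0_norm (invcard_ge0 V)).
by apply: ler_wpM2l (invcard_ge0 V) _ _ _; apply: ler_norm_sum.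
Qed.

Lemma mean_shift V (f : V -> R) h : mean (fun x => f (x + h)) = mean f.
Proof.
congr (_ * _); rewrite [RHS](reindex_inj (addIr h)) //.
Qed.

Lemma mean_shiftl V (f : V -> R) h : mean (fun x => f (h + x)) = mean f.
Proof. by rewrite -(mean_shift f h); apply: eq_mean => x; rewrite addrC. Qed.

Lemma mean_pair V W (f : V * W -> R) :
  mean f = mean (fun x => mean (fun y => f (x, y))).
Proof.
rewrite /mean card_prod natrM invfM -mulrA; congr (_ * _).
by rewrite -mulr_sumr pair_bigA; congr (_ * _); apply: eq_bigr => -[].
Qed.

Lemma exchange_mean V W (f : V -> W -> R) :
  mean (fun x => mean (f x)) = mean (fun y => mean (f ^~ y)).
Proof.
by rewrite /mean -!mulr_sumr mulrCA exchange_big.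
Qed.

Lemma exists_le_mean V (f : V -> R) : exists x, f x <= mean f.
Proof.
apply: contrapT => /forallNP H.
have : \sum_(x : V) mean f < \sum_(x : V) f x.
  apply: ltr_sum => [|x _]; last by rewrite ltNge; apply/negP/H.
  by apply/hasP; exists 0; rewrite ?mem_index_enum.
rewrite sumr_const -[mean f *+ _]mulr_natl /mean mulrA divff ?mul1r ?ltxx //.
by rewrite gt_eqF ?card_gt0R.
Qed.

End Mean.

(** * Phase polynomials with values 1 and -1 *)

Section PhasePolynomial.
Variable R : realType.
Implicit Types V W : finZmodType.

(** A sign is its own inverse, so [phi (x + h) * phi x] is the multiplicative derivative along
    [h]. *)
Fixpoint deriv_deg V d (phi : V -> R) : Prop :=
  if d is d'.+1 then forall h, deriv_deg d' (fun x => phi (x + h) * phi x)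
  else forall x y, phi x = phi y.

Definition phase V d (phi : V -> R) : Prop :=
  (forall x, phi x * phi x = 1) /\ deriv_deg d phi.

Lemma phase_deriv V d (phi : V -> R) h :
  phase d.+1 phi -> phase d (fun x => phi (x + h) * phi x).
Proof.
by case=> s D; split=> [x|]; [rewrite mulrACA !s mulr1 | apply: D].
Qed.

Lemma deriv_degS V d (phi : V -> R) : deriv_deg d phi -> deriv_deg d.+1 phi.
Proof.
elim: d phi => [|d IH] phi D h; last exact/IH/D.
by move=> x y; rewrite (D (x + h) (y + h)) (D x y).
Qed.

Lemma phaseS V d (phi : V -> R) : phase d phi -> phase d.+1 phi.
Proof. by case=> s D; split=> //; apply: deriv_degS. Qed.

Lemma deriv_degM V d (phi psi : V -> R) : deriv_deg d phi -> deriv_deg d psi ->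
  deriv_deg d (fun x => phi x * psi x).
Proof.
elim: d phi psi => [|d IH] phi psi D E.
  by move=> x y; rewrite (D x y) (E x y).
move=> h; have := IH _ _ (D h) (E h).
by congr deriv_deg; apply/funext => x; rewrite mulrACA.
Qed.

Lemma phaseM V d (phi psi : V -> R) : phase d phi -> phase d psi ->
  phase d (fun x => phi x * psi x).
Proof.
move=> [s D] [t E]; split=> [x|]; first by rewrite mulrACA s t mulr1.
exact: deriv_degM.
Qed.

Lemma phase_cst V d (c : R) : c * c = 1 -> phase d (fun _ : V => c).
Proof. by move=> c1; split=> //; elim: d => // d; apply: deriv_degS. Qed.

Definition affine V W (F : W -> V) : Prop :=
  exists G : W -> V, forall w h, F (w + h) = F w + G h.

Lemma phase_comp V W d (phi : V -> R) (F : W -> V) :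
  affine F -> phase d phi -> phase d (fun w => phi (F w)).
Proof.
move=> [G FG] [s D]; split=> // {s}.
elim: d phi D => [|d IH] phi D; first by move=> x y; apply: D.
move=> h; have := IH _ (D (G h)).
by congr deriv_deg; apply/funext => x; rewrite FG.
Qed.

Lemma affine_fst V W : affine (fun p : V * W => p.1).
Proof. by exists fst. Qed.

Lemma affine_pairl V W (y : W) : affine (fun x : V => (x, y)).
Proof. by exists (fun x => (x, 0)) => x h; congr (_, _); rewrite addr0. Qed.

Lemma sign_cases (c : R) : c * c = 1 -> c = 1 \/ c = -1.
Proof.
by move=> /eqP; rewrite -expr2 sqrf_eq1 => /orP[] /eqP; [left|right].
Qed.

Lemma sign_norm (c : R) : c * c = 1 -> `|c| = 1.
Proof. by case/sign_cases=> ->; rewrite ?normrN normr1. Qed.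

End PhasePolynomial.

(** * Cubes and products over their vertices *)

Section Cube.
Variables (R : realType) (V : finZmodType).
Implicit Types phi psi : V -> R.

(** A point lists [k] shifts, followed by a base coordinate in [V]. *)
Fixpoint cube k : finZmodType :=
  if k is k'.+1 then (V * cube k')%type else V.

(** The product of [phi] over the [2 ^ k] vertices of the cube at [x]; [punctured] omits the vertex
    [x] itself. *)
Fixpoint mderiv k phi x : cube k -> R :=
  if k is k'.+1 return cube k -> R then
    fun w => mderiv phi (x + w.1) w.2 * mderiv phi x w.2
  else fun _ => phi x.

Fixpoint punctured k phi x : cube k -> R :=
  if k is k'.+1 return cube k -> R then
    fun w => mderiv phi (x + w.1) w.2 * punctured phi x w.2
  else fun _ => 1.

Lemma mderiv_punctured k phi x (w : cube k) :
  mderiv phi x w = phi x * punctured phi x w.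
Proof.
elim: k w => [|k IH] w /=; first by rewrite mulr1.
by rewrite IH mulrCA.
Qed.

Lemma mderivM k phi psi x (w : cube k) :
  mderiv (fun x => phi x * psi x) x w = mderiv phi x w * mderiv psi x w.
Proof. by elim: k x w => //= k IH x w; rewrite !IH mulrACA. Qed.

Lemma mderiv_shift k phi h x (w : cube k) :
  mderiv (fun x => phi (x + h)) x w = mderiv phi (x + h) w.
Proof. by elim: k x w => //= k IH x w; rewrite !IH addrAC. Qed.

Lemma mderiv_phase d phi x (w : cube d.+1) : phase d phi -> mderiv phi x w = 1.
Proof.
elim: d phi w => [|d IH] phi w P.
  by case: P => s D /=; rewrite (D _ x) s.
by rewrite -[RHS](IH _ w.2 (phase_deriv w.1 P)) mderivM mderiv_shift.
Qed.

Lemma punctured_phase d phi x (w : cube d.+1) : phase d phi ->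
  punctured phi x w = phi x.
Proof.
move=> P; have := mderiv_phase x w P; rewrite mderiv_punctured => E.
by rewrite -[LHS]mul1r -(P.1 x) -mulrA E mulr1.
Qed.

Lemma mderiv_sign k phi x (w : cube k) : (forall x, phi x * phi x = 1) ->
  mderiv phi x w * mderiv phi x w = 1.
Proof. by move=> s; elim: k x w => //= k IH x w; rewrite mulrACA !IH mulr1. Qed.

Lemma punctured_sign k phi x (w : cube k) : (forall x, phi x * phi x = 1) ->
  punctured phi x w * punctured phi x w = 1.
Proof.
move=> s; elim: k x w => /= [|k IH] x w; first by rewrite mulr1.
by rewrite mulrACA IH mderiv_sign ?mulr1.
Qed.

Lemma dist_mul_sign (a b a' b' : R) : a' * a' = 1 -> b * b = 1 ->
  `|a * b - a' * b'| <= `|a - a'| + `|b - b'|.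
Proof.
move=> /sign_norm a1 /sign_norm b1.
have -> : a * b - a' * b' = (a - a') * b + a' * (b - b') by ring.
by apply: le_trans (ler_normD _ _) _; rewrite !normrM a1 b1 mulr1 mul1r.
Qed.

(** For uniform [x] each of the [2 ^ k] vertices is uniform, so replacing [phi] by [psi] at one
    vertex costs one L^1 distance. *)
Lemma mderiv_dist k phi psi :
  (forall x, phi x * phi x = 1) -> (forall x, psi x * psi x = 1) ->
  mean (fun x => mean (fun w : cube k => `|mderiv phi x w - mderiv psi x w|)) <=
  2 ^+ k * mean (fun x => `|phi x - psi x|).
Proof.
move=> s t; elim: k => [|k IH].
  by rewrite expr0 mul1r; apply: le_mean => x; rewrite /= mean_cst.
apply: le_trans (_ : mean (fun x => mean (fun w : cube k.+1 =>
  `|mderiv phi (x + w.1) w.2 - mderiv psi (x + w.1) w.2| +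
  `|mderiv phi x w.2 - mderiv psi x w.2|)) <= _).
  by do 2!apply: le_mean => ?; apply: dist_mul_sign; apply: mderiv_sign.
under eq_mean => x do rewrite meanD !mean_pair /= mean_cst.
rewrite meanD exchange_mean.
under eq_mean => h do rewrite (mean_shift (fun x => mean (fun w : cube k =>
  `|mderiv phi x w - mderiv psi x w|)) h).
by rewrite mean_cst exprS -mulrA mulr_natl mulr2n; apply: lerD.
Qed.

(* Each vertex of the punctured cube at x is uniformly distributed, which is
   why the bound holds for every single x. *)
Lemma punctured_dist k phi psi x :
  (forall x, phi x * phi x = 1) -> (forall x, psi x * psi x = 1) ->
  mean (fun w : cube k => `|punctured phi x w - punctured psi x w|) <=
  2 ^+ k * mean (fun x => `|phi x - psi x|).
Proof.
move=> s t; elim: k => [|k IH].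
  rewrite /= subrr normr0 mean_cst mulr_ge0 ?exprn_ge0 //; exact: mean_ge0.
apply: le_trans (_ : mean (fun w : cube k.+1 =>
  `|mderiv phi (x + w.1) w.2 - mderiv psi (x + w.1) w.2| +
  `|punctured phi x w.2 - punctured psi x w.2|) <= _).
  apply: le_mean => ?; apply: dist_mul_sign; first exact: mderiv_sign.
  exact: punctured_sign.
rewrite meanD !mean_pair /= mean_cst.
rewrite (mean_shiftl (fun x => mean (fun w : cube k =>
  `|mderiv phi x w - mderiv psi x w|)) x).
by rewrite exprS -mulrA mulr_natl mulr2n; apply: lerD IH; apply: mderiv_dist.
Qed.

End Cube.

(** * The ring of dyadic numbers *)

Section Dyadic.
Variable R : realType.

Lemma dyadic_int (a : int) : dyadic (a%:~R : R).
Proof. by exists a, 0%N; rewrite expr0 divr1. Qed.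

Lemma dyadic0 : dyadic (0 : R). Proof. exact: (dyadic_int 0). Qed.

Lemma dyadic1 : dyadic (1 : R). Proof. exact: (dyadic_int 1). Qed.

Lemma dyadicN1 : dyadic (-1 : R).
Proof. by rewrite -[-1]/(-1%:~R) -mulrNz; apply: dyadic_int. Qed.

Lemma dyadic_half : dyadic (2^-1 : R).
Proof. by exists 1, 1%N; rewrite expr1 mul1r. Qed.

Lemma pow2_unit n : (2 : R) ^+ n != 0.
Proof. by rewrite expf_neq0 // pnatr_eq0. Qed.

Lemma dyadicM (x y : R) : dyadic x -> dyadic y -> dyadic (x * y).
Proof.
move=> [a [m ->]] [b [n ->]]; exists (a * b), (m + n)%N.
by rewrite intrM exprD invfM mulrACA.
Qed.

Lemma dyadicD (x y : R) : dyadic x -> dyadic y -> dyadic (x + y).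
Proof.
move=> [a [m ->]] [b [n ->]]; exists (a * 2 ^+ n + b * 2 ^+ m), (m + n)%N.
rewrite intrD !intrM !rmorphXn /= exprD.
by field; rewrite !pow2_unit.
Qed.

End Dyadic.

(** * Combinations of boundedly many phases over a family of groups *)

Section Combination.
Variables (R : realType) (I : Type).
Implicit Types (V W : I -> finZmodType) (K : R -> Prop).

(* The number of terms and the coefficients do not depend on the index i. *)
Inductive combo K d V : (forall i, V i -> R) -> Prop :=
| combo0 : combo K d (fun i (_ : V i) => 0)
| comboS c phi f : K c -> (forall i, phase d (phi i)) -> combo K d f ->
    combo K d (fun i (x : V i) => c * phi i x + f i x).

Lemma combo_ext K d V (f g : forall i, V i -> R) :
  combo K d f -> (forall i x, f i x = g i x) -> combo K d g.
Proof.
move=> Cf fg; suff <- : f = g by [].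
by apply: functional_extensionality_dep => i; apply/funext.
Qed.

Lemma combo_phase K d V (phi : forall i, V i -> R) c : K c ->
  (forall i, phase d (phi i)) -> combo K d (fun i x => c * phi i x).
Proof.
move=> Kc P; apply: (combo_ext (comboS Kc P (combo0 K d V))) => i x.
by rewrite addr0.
Qed.

Lemma combo_cst K d V c : K c -> combo K d (fun i (_ : V i) => c).
Proof.
move=> Kc; apply: combo_ext (combo_phase (phi := fun i (_ : V i) => 1) Kc _) _.
  by move=> i; apply: phase_cst; rewrite mulr1.
by move=> i x; rewrite mulr1.
Qed.

Lemma comboD K d V (f g : forall i, V i -> R) :
  combo K d f -> combo K d g -> combo K d (fun i x => f i x + g i x).
Proof.
move=> Cf Cg; elim: Cf => [|c phi {}f Kc P _ IH].
  by apply: (combo_ext Cg) => i x; rewrite add0r.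
by apply: (combo_ext (comboS Kc P IH)) => i x; rewrite addrA.
Qed.

Lemma combo_phaseM K d V (phi f : forall i, V i -> R) :
  (forall i, phase d (phi i)) -> combo K d f ->
  combo K d (fun i x => phi i x * f i x).
Proof.
move=> P; elim=> [|c psi {}f Kc Q _ IH].
  by apply: (combo_ext (combo0 K d V)) => i x; rewrite mulr0.
apply: (combo_ext (comboS Kc (fun i => phaseM (P i) (Q i)) IH)) => i x.
by rewrite mulrDr mulrCA.
Qed.

Lemma combo_comp K d V W (F : forall i, W i -> V i) (f : forall i, V i -> R) :
  (forall i, affine (F i)) -> combo K d f -> combo K d (fun i w => f i (F i w)).
Proof.
move=> AF; elim=> [|c phi {}f Kc P _ IH]; first exact: combo0.
exact: (comboS Kc (fun i => phase_comp (AF i) (P i)) IH).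
Qed.

Lemma comboSdeg K d V (f : forall i, V i -> R) :
  combo K d f -> combo K d.+1 f.
Proof.
elim=> [|c phi {}f Kc P _ IH]; first exact: combo0.
exact: (comboS Kc (fun i => phaseS (P i)) IH).
Qed.

Lemma combo_sub K (K' : R -> Prop) d V (f : forall i, V i -> R) :
  (forall c, K c -> K' c) -> combo K d f -> combo K' d f.
Proof.
move=> KK; elim=> [|c phi {}f Kc P _ IH]; first exact: combo0.
exact: (comboS (KK _ Kc) P IH).
Qed.

Section Product.
Variables (K : R -> Prop) (d : nat) (V : I -> finZmodType).
Hypothesis KM : forall a b, K a -> K b -> K (a * b).
Implicit Types f g : forall i, V i -> R.

Lemma comboZ c f : K c -> combo K d f -> combo K d (fun i x => c * f i x).
Proof.
move=> Kc; elim=> [|b phi {}f Kb P _ IH].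
  by apply: (combo_ext (combo0 K d V)) => i x; rewrite mulr0.
apply: (combo_ext (comboS (KM Kc Kb) P IH)) => i x.
by rewrite mulrDr mulrA.
Qed.

Lemma comboM f g : combo K d f -> combo K d g ->
  combo K d (fun i x => f i x * g i x).
Proof.
move=> Cf Cg; elim: Cf => [|c phi {}f Kc P _ IH].
  by apply: (combo_ext (combo0 K d V)) => i x; rewrite mul0r.
apply: (combo_ext (comboD (comboZ Kc (combo_phaseM P Cg)) IH)) => i x.
by rewrite mulrDl mulrA.
Qed.

End Product.

(** The value at 0 is 1, so that rounding always yields a sign. *)
Definition dsgn (t : R) : R := if 0 <= t then 1 else -1.

Lemma dsgn_sqr t : dsgn t * dsgn t = 1.
Proof. by rewrite /dsgn; case: ifP; rewrite ?mulrNN mulr1. Qed.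

Lemma dyadic_dsgn t : dyadic (dsgn t).
Proof. by rewrite /dsgn; case: ifP => _; [apply: dyadic1|apply: dyadicN1]. Qed.

(* A function of finitely many signs is, by Fourier expansion on the discrete
   cube, a combination of their products, with dyadic coefficients. *)
Lemma combo_dsgn K d V (f : forall i, V i -> R) a :
  combo K d f -> combo (@dyadic R) d (fun i x => dsgn (a + f i x)).
Proof.
move=> Cf; elim: Cf a => [|c phi {}f Kc P _ IH] a.
  by apply: (combo_ext (combo_cst d V (dyadic_dsgn a))) => i x; rewrite addr0.
(* [(1 + phi) / 2] and [(1 - phi) / 2] indicate where [phi] is 1 and where it is -1. On either set
   [c * phi] is constant and moves into [a], so the real number [c] leaves the coefficients. *)
have hphi := combo_phase (dyadic_half R) P.
have hNphi := combo_phase (dyadicM (dyadicN1 R) (dyadic_half R)) P.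
have h1 := combo_cst d V (dyadic_half R).
have A := comboM (@dyadicM R) (comboD h1 hphi) (IH (a + c)).
have B := comboM (@dyadicM R) (comboD h1 hNphi) (IH (a - c)).
apply: (combo_ext (comboD A B)) => i x /=.
case: (sign_cases ((P i).1 x)) => ->.
  have -> : 2^-1 + 2^-1 * 1 = 1 :> R by lra.
  have -> : 2^-1 + -1 * 2^-1 * 1 = 0 :> R by lra.
  by rewrite mul0r addr0 mul1r mulr1 addrA.
have -> : 2^-1 + 2^-1 * -1 = 0 :> R by lra.
have -> : 2^-1 + -1 * 2^-1 * -1 = 1 :> R by lra.
by rewrite mul0r add0r mul1r mulrN1 addrA.
Qed.

(** The combination lives on the group of pairs (base point, shifts), so that the shifts can be
    averaged out later. Two opposite faces of a cube are affine images of it. *)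
Lemma combo_mderiv k d V (psi : forall i, V i -> R) :
  combo (@dyadic R) d psi ->
  combo (@dyadic R) d
    (fun i (p : V i * cube (V i) k) => mderiv (psi i) p.1 p.2).
Proof.
move=> Cp; elim: k => [|k IH] /=.
  by apply: combo_comp Cp => i; apply: affine_fst.
apply: (comboM (@dyadicM R)).
  apply: (combo_comp (W := fun i => (V i * (V i * cube (V i) k))%type)
    (F := fun i p => (p.1 + p.2.1, p.2.2)) _ IH).
  move=> i; exists (fun p => (p.1 + p.2.1, p.2.2)) => w h.
  by congr (_, _) => /=; rewrite addrACA.
apply: (combo_comp (W := fun i => (V i * (V i * cube (V i) k))%type)
    (F := fun i p => (p.1, p.2.2)) _ IH).
by move=> i; exists (fun p => (p.1, p.2.2)).
Qed.

Lemma combo_punctured k d V (psi : forall i, V i -> R) :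
  combo (@dyadic R) d psi ->
  combo (@dyadic R) d
    (fun i (p : V i * cube (V i) k) => punctured (psi i) p.1 p.2).
Proof.
move=> Cp; elim: k => [|k IH] /=; first exact/combo_cst/dyadic1.
apply: (comboM (@dyadicM R)).
  apply: (combo_comp (W := fun i => (V i * (V i * cube (V i) k))%type)
    (F := fun i p => (p.1 + p.2.1, p.2.2)) _ (combo_mderiv k Cp)).
  move=> i; exists (fun p => (p.1 + p.2.1, p.2.2)) => w h.
  by congr (_, _) => /=; rewrite addrACA.
apply: (combo_comp (W := fun i => (V i * (V i * cube (V i) k))%type)
    (F := fun i p => (p.1, p.2.2)) _ IH).
by move=> i; exists (fun p => (p.1, p.2.2)).
Qed.

End Combination.

(** * Limits along an ultrafilter and almost everywhere continuity *)

Section Limit.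
Variables (R : realType) (I : Type) (U : set_system I).
Hypothesis UU : UltraFilter U.
Implicit Types V Y : I -> finZmodType.

Definition tends0 (a : I -> R) : Prop :=
  forall eta, 0 < eta -> U (fun i => `|a i| <= eta).

Definition null V (e : forall i, V i -> R) : Prop :=
  (forall i x, 0 <= e i x) /\ tends0 (fun i => mean (e i)).

Lemma filter_forall (P : I -> Prop) : (forall i, P i) -> U P.
Proof. by move=> HP; apply: filterS filterT => i _; apply: HP. Qed.

Lemma tends0_le (a b : I -> R) :
  U (fun i => `|a i| <= b i) -> tends0 b -> tends0 a.
Proof.
move=> ab b0 eta eta0; apply: filterS2 ab (b0 _ eta0) => i h1 h2.
exact: le_trans h1 (le_trans (ler_norm _) h2).
Qed.

Lemma tends0D a b : tends0 a -> tends0 b -> tends0 (fun i => a i + b i).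
Proof.
move=> a0 b0 eta eta0; have h : 0 < eta / 2 by lra.
apply: filterS2 (a0 _ h) (b0 _ h) => i h1 h2.
by apply: le_trans (ler_normD _ _) _; lra.
Qed.

Lemma tends0Z c a : tends0 a -> tends0 (fun i => c * a i).
Proof.
move=> a0 eta eta0; have c0 : 0 < `|c| + 1 by rewrite ltr_wpDl.
apply: filterS (a0 _ (divr_gt0 eta0 c0)) => i.
rewrite ler_pdivlMr // normrM => h; apply: le_trans h.
by rewrite mulrC ler_wpM2l // lerDl.
Qed.

Lemma tends0_0 : tends0 (fun _ => 0).
Proof. by move=> eta h; apply: filter_forall => i; rewrite normr0 ltW. Qed.

Lemma tends0_ext a b : tends0 a -> (forall i, a i = b i) -> tends0 b.
Proof. by move=> a0 ab; have <- : a = b by apply/funext. Qed.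

Lemma not_tends0 a : ~ tends0 a ->
  exists2 delta, 0 < delta & U (fun i => delta <= `|a i|).
Proof.
move=> /existsNP[eta /not_implyP[eta0 H]]; exists eta => //.
have [//|HC] := in_ultra_setVsetC (fun i => `|a i| <= eta) UU.
by apply: filterS HC => i /negP; rewrite -ltNge => /ltW.
Qed.

Lemma null0 V : null (fun i (_ : V i) => 0).
Proof.
split=> //; apply: (tends0_ext tends0_0) => i; by rewrite mean_cst.
Qed.

Lemma nullD V (e e' : forall i, V i -> R) :
  null e -> null e' -> null (fun i x => e i x + e' i x).
Proof.
move=> [e0 en] [e0' en']; split=> [i x|]; first exact: addr_ge0.
by apply: (tends0_ext (tends0D en en')) => i; rewrite meanD.
Qed.

Lemma nullZ V (e : forall i, V i -> R) c : 0 <= c ->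
  null e -> null (fun i x => c * e i x).
Proof.
move=> c0 [e0 en]; split=> [i x|]; first exact: mulr_ge0.
by apply: (tends0_ext (tends0Z c en)) => i; rewrite meanZ.
Qed.

Lemma null_mean V Y (e : forall i, V i * Y i -> R) :
  null e -> null (fun i x => mean (fun y => e i (x, y))).
Proof.
move=> [e0 en]; split=> [i x|]; first exact: mean_ge0.
by apply: (tends0_ext en) => i; rewrite mean_pair.
Qed.

(* f is, up to an infinitesimal in L^1, a uniform limit of finite combinations
   of phase polynomials of degree d: an almost everywhere continuous function
   on the limit space cut out by these polynomials. *)
Definition ae_cont d V (f : forall i, V i -> R) : Prop :=
  forall eps, 0 < eps -> exists g e,
    [/\ combo (fun _ => True) d g, null e &
        forall i x, `|f i x - g i x| <= eps + e i x].

Lemma combo_ae_cont K d V (f : forall i, V i -> R) : combo K d f -> ae_cont d f.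
Proof.
move=> Cf eps eps0; exists f, (fun i _ => 0); split; last 1 first.
- by move=> i x; rewrite subrr normr0 addr0 ltW.
- by apply: combo_sub Cf.
- exact: null0.
Qed.

Lemma ae_cont_ext d V (f g : forall i, V i -> R) :
  ae_cont d f -> (forall i x, f i x = g i x) -> ae_cont d g.
Proof.
move=> Cf fg; suff <- : f = g by [].
by apply: functional_extensionality_dep => i; apply/funext.
Qed.

Lemma ae_contD d V (f g : forall i, V i -> R) :
  ae_cont d f -> ae_cont d g -> ae_cont d (fun i x => f i x + g i x).
Proof.
move=> Cf Cg eps eps0; have h : 0 < eps / 2 by lra.
have [f' [e [Cf' ne fe]]] := Cf _ h; have [g' [e' [Cg' ne' ge]]] := Cg _ h.
exists (fun i x => f' i x + g' i x), (fun i x => e i x + e' i x); split.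
- exact: comboD.
- exact: nullD.
move=> i x; rewrite opprD addrACA; apply: le_trans (ler_normD _ _) _.
by have := fe i x; have := ge i x; lra.
Qed.

Lemma ae_contZ d V (f : forall i, V i -> R) c :
  ae_cont d f -> ae_cont d (fun i x => c * f i x).
Proof.
move=> Cf eps eps0; have c0 : 0 < `|c| + 1 by rewrite ltr_wpDl.
have [g [e [Cg ne fe]]] := Cf _ (divr_gt0 eps0 c0).
exists (fun i x => c * g i x), (fun i x => `|c| * e i x); split.
- exact: comboZ.
- exact: nullZ.
move=> i x; rewrite -mulrBr normrM.
apply: le_trans (ler_wpM2l (normr_ge0 c) (fe i x)) _.
rewrite mulrDr lerD2r mulrA ler_pdivrMr // mulrC ler_wpM2l ?ltW //.
by rewrite ltrDl.
Qed.

Lemma ae_cont_phaseM d V (phi f : forall i, V i -> R) :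
  (forall i, phase d (phi i)) -> ae_cont d f ->
  ae_cont d (fun i x => phi i x * f i x).
Proof.
move=> P Cf eps eps0; have [g [e [Cg ne fe]]] := Cf _ eps0.
exists (fun i x => phi i x * g i x), e; split=> //; first exact: combo_phaseM.
by move=> i x; rewrite -mulrBr normrM (sign_norm ((P i).1 x)) mul1r.
Qed.

Lemma ae_cont_null d V (f F e : forall i, V i -> R) :
  ae_cont d f -> null e -> (forall i x, `|F i x - f i x| <= e i x) ->
  ae_cont d F.
Proof.
move=> Cf ne Fe eps eps0; have [g [e' [Cg ne' fe]]] := Cf _ eps0.
exists g, (fun i x => e i x + e' i x); split=> //; first exact: nullD.
move=> i x; rewrite -(subrK (f i x) (F i x)) -addrA.
apply: le_trans (ler_normD _ _) _.
by have := Fe i x; have := fe i x; lra.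
Qed.

Lemma ae_contS d V (f : forall i, V i -> R) : ae_cont d f -> ae_cont d.+1 f.
Proof.
move=> Cf eps eps0; have [g [e [Cg ne fe]]] := Cf _ eps0.
by exists g, e; split=> //; apply: comboSdeg.
Qed.

(** The approximation is 0, as [t <= eps + t ^ 2 / eps] for [t >= 0] and the last term is null. *)
Lemma tends0_sqr_ae_cont d V (f : forall i, V i -> R) :
  tends0 (fun i => mean (fun x => f i x * f i x)) -> ae_cont d f.
Proof.
move=> f0 eps eps0; exists (fun i _ => 0).
exists (fun i x => eps^-1 * (f i x * f i x)).
split; first exact: combo0.
  apply: nullZ; first by rewrite invr_ge0 ltW.
  by split=> // i x; rewrite -expr2 sqr_ge0.
move=> i x; rewrite subr0 -expr2 -real_normK ?num_real //.
move: `|f i x| (normr_ge0 (f i x)) => t t0.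
rewrite -(ler_pM2l eps0) mulrDr mulrA divff ?gt_eqF // mul1r; nra.
Qed.

(** With shifts of cubes as [Y], this makes averages over the cubes at [x] almost everywhere
    continuous in [x]. *)
Definition fiber_cont d : Prop := forall V Y (P : forall i, V i * Y i -> R),
  (forall i, phase d (P i)) ->
  ae_cont d (fun i x => mean (fun y => P i (x, y))).

Lemma fiber_cont_combo K d V Y (f : forall i, V i * Y i -> R) :
  fiber_cont d -> combo K d f ->
  ae_cont d (fun i x => mean (fun y => f i (x, y))).
Proof.
move=> FC; elim=> [|c phi {}f Kc P _ IH].
  apply: (ae_cont_ext (combo_ae_cont (combo0 xpredT d V))) => i x.
  by rewrite mean_cst.
apply: (ae_cont_ext (ae_contD (ae_contZ c (FC _ _ _ P)) IH)) => i x.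
by rewrite meanD meanZ.
Qed.

End Limit.

(** * Sampling a biased sign by finitely many shifts *)

Section Sampling.
Variable R : realType.

Lemma eq_ler (x y : R) : x = y -> x <= y.
Proof. by move=> ->. Qed.

(* The shifts are chosen greedily: averaged over the next shift h, the mean
   square error grows by the variance of phi (x + h), which is at most 1. *)
Lemma sample_shifts (V : finZmodType) (phi : V -> R) m :
  (forall x, phi x * phi x = 1) ->
  exists hs : seq V, size hs = m /\
    mean (fun x => (\sum_(h <- hs) phi (x + h) * phi x -
                    m%:R * mean phi * phi x) ^+ 2) <= m%:R.
Proof.
move=> s; elim: m => [|m [hs [szhs IH]]].
  exists [::]; split=> //; rewrite -[leRHS](mean_cst V); apply: le_mean => x.
  by rewrite big_nil !mul0r subrr expr0n.
set b := mean phi in IH *.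
pose S x := \sum_(h <- hs) phi (x + h) * phi x - m%:R * b * phi x.
have [h hle] := exists_le_mean
  (fun h => mean (fun x => (S x + (phi (x + h) * phi x - b * phi x)) ^+ 2)).
exists (h :: hs); split; first by rewrite /= szhs.
apply: le_trans (_ : mean (fun x =>
    (S x + (phi (x + h) * phi x - b * phi x)) ^+ 2) <= _).
  apply: le_mean => x; rewrite big_cons /S -natr1.
  by apply: eq_ler; congr (_ ^+ 2); ring.
apply: le_trans hle _; rewrite exchange_mean.
apply: le_trans (_ : mean (fun x => S x ^+ 2 + 1) <= _); last first.
  by rewrite meanD mean_cst -natr1 lerD2r.
apply: le_mean => x.
(* As [phi] is a sign, the square is affine in [phi (x + h)], whose mean over [h] is [b]. What
   remains is [S x ^ 2 + 1 - b ^ 2]. *)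
apply: le_trans (_ : mean (fun h =>
   (S x ^+ 2 - 2 * S x * b * phi x + 1 + b ^+ 2)
   + (2 * S x * phi x - 2 * b) * phi (x + h)) <= _).
  apply: le_mean => h'; apply: eq_ler.
  have := s (x + h'); have := s x.
  move: (phi x) (phi (x + h')) (S x) => p q t hp hq.
  have -> : (t + (q * p - b * p)) ^+ 2 = t ^+ 2 + 2 * t * (q * p - b * p) +
    (q * q) * (p * p) - 2 * b * q * (p * p) + b ^+ 2 * (p * p) by ring.
  by rewrite hp hq; ring.
rewrite meanD mean_cst meanZ (mean_shiftl phi x) -/b.
have : 0 <= b ^+ 2 by apply: sqr_ge0.
lra.
Qed.

(** The left side is 0 or 2. It is 2 only if [t] is 0 or has the sign opposite to [b * p], and then
    [(t - b * p) ^ 2 >= b ^ 2]. *)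
Lemma dist_dsgn (p t b : R) : p * p = 1 -> b != 0 ->
  `|p - dsgn (dsgn b * t)| <= 2 * (t - b * p) ^+ 2 / b ^+ 2.
Proof.
move=> /sign_cases p1 b0.
have b2 : 0 < b ^+ 2 by rewrite exprn_even_gt0.
rewrite ler_pdivlMr //; rewrite /dsgn.
case: (lerP 0 b) => hb; [rewrite mul1r|rewrite mulN1r].
  have {}hb : 0 < b by rewrite lt_def b0.
  case: p1 => ->; case: ifP => /= [ht|/negbT]; rewrite -?ltNge.
  - by rewrite subrr normr0 mul0r mulr_ge0 // sqr_ge0.
  - move=> ht; rewrite opprK ger0_norm; nra.
  - rewrite -opprD normrN ger0_norm; nra.
  - by rewrite subrr normr0 mul0r mulr_ge0 // sqr_ge0.
case: p1 => ->; case: ifP => /= [ht|/negbT]; rewrite -?ltNge.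
- by rewrite subrr normr0 mul0r mulr_ge0 // sqr_ge0.
- move=> ht; rewrite opprK ger0_norm; nra.
- rewrite -opprD normrN ger0_norm; nra.
- by rewrite subrr normr0 mul0r mulr_ge0 // sqr_ge0.
Qed.

(** [dist_dsgn] with [m * mean phi] as [b] divides the mean square error, at most [m], by
    [(m * mean phi) ^ 2]. *)
Lemma sample_sign (V : finZmodType) (phi : V -> R) m :
  (forall x, phi x * phi x = 1) -> mean phi != 0 -> (0 < m)%N ->
  exists hs : seq V, size hs = m /\
    mean (fun x => `|phi x -
      dsgn (dsgn (mean phi) * \sum_(h <- hs) phi (x + h) * phi x)|) <=
    2 / (m%:R * mean phi ^+ 2).
Proof.
move=> s b0 m0; have [hs [szhs H]] := sample_shifts m s; exists hs; split=> //.
set b := mean phi in b0 H *.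
have mp : 0 < m%:R :> R by rewrite ltr0n.
have mb : m%:R * b != 0 by apply: mulf_neq0 => //; rewrite gt_eqF.
have dm : dsgn (m%:R * b) = dsgn b by rewrite /dsgn pmulr_rge0.
apply: le_trans (_ : mean (fun x => (2 / (m%:R * b) ^+ 2) *
  (\sum_(h <- hs) phi (x + h) * phi x - m%:R * b * phi x) ^+ 2) <= _).
  apply: le_mean => x; rewrite -dm mulrAC; exact: dist_dsgn (s x) mb.
rewrite meanZ; apply: le_trans (ler_wpM2l _ H) _.
  by rewrite mulr_ge0 ?invr_ge0 ?sqr_ge0.
by apply: eq_ler; field; rewrite b0 (gt_eqF mp).
Qed.

End Sampling.

(** * Structure of biased phases and limits of means *)

Section Structure.
Variables (R : realType) (I : Type) (U : set_system I).
Hypothesis UU : UltraFilter U.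
Implicit Types V Y : I -> finZmodType.

(** Each summand is a derivative of [phi i] up to sign, hence of degree [d]. The shifts vary with
    [i], their number does not. *)
Lemma combo_shifts d V (phi : forall i, V i -> R) (c : I -> R)
    (hs : forall i, seq (V i)) m :
  (forall i, phase d.+1 (phi i)) -> (forall i, c i * c i = 1) ->
  (forall i, size (hs i) = m) ->
  combo (@dyadic R) d
    (fun i x => c i * \sum_(h <- hs i) phi i (x + h) * phi i x).
Proof.
move=> P cc; elim: m hs => [|m IH] hs szhs.
  apply: (combo_ext (combo0 _ d V)) => i x.
  by rewrite (size0nil (szhs i)) big_nil mulr0.
have sz' i : size (behead (hs i)) = m by rewrite size_behead szhs.
have Ph i : phase d (fun x => c i * (phi i (x + head 0 (hs i)) * phi i x)).
  by apply: phaseM; [apply: phase_cst | apply: phase_deriv].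
apply: (combo_ext (comboS (dyadic1 R) Ph (IH _ sz'))) => i x.
move: (szhs i); case: (hs i) => // h s _ /=.
by rewrite big_cons mulrDr mul1r.
Qed.

Lemma biased_approx d V (phi : forall i, V i -> R) (delta eps : R) :
  (forall i, phase d.+1 (phi i)) -> 0 < delta -> 0 < eps ->
  exists psi : forall i, V i -> R, [/\ combo (@dyadic R) d psi,
    forall i x, psi i x * psi i x = 1 &
    forall i, delta <= `|mean (phi i)| ->
      mean (fun x => `|phi i x - psi i x|) <= eps].
Proof.
move=> P d0 e0.
(* The number of samples depends on [delta] and [eps] only, hence is the same for all [i]. *)
have [m m0 mP] : exists2 m, (0 < m)%N & 2 / (m%:R * delta ^+ 2) <= eps.
  have d2 : 0 < delta ^+ 2 by apply: exprn_gt0.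
  have := archi_boundP (ltW (divr_gt0 (ltr0n R 2) (mulr_gt0 e0 d2))).
  set m := Num.bound _ => hm; exists m.+1 => //.
  rewrite ler_pdivrMr ?mulr_gt0 ?ltr0n //.
  move: hm; rewrite ltr_pdivrMr ?mulr_gt0 // -natr1 => hm.
  have := mulr_gt0 e0 d2; nra.
have H i : exists hs : seq (V i), size hs = m /\
    (delta <= `|mean (phi i)| -> mean (fun x => `|phi i x -
      dsgn (dsgn (mean (phi i)) * \sum_(h <- hs) phi i (x + h) * phi i x)|)
      <= eps).
  case: (lerP delta `|mean (phi i)|) => hd; last first.
    (* Below the bias [delta], default shifts provide the common length [m]. *)
    by exists (nseq m 0); rewrite size_nseq.
  have b0 : mean (phi i) != 0 by rewrite -normr_gt0 (lt_le_trans d0).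
  have [hs [szhs hle]] := sample_sign (P i).1 b0 m0.
  exists hs; split=> // _; apply: le_trans hle (le_trans _ mP).
  have mp : 0 < m%:R :> R by rewrite ltr0n.
  have b2 : delta ^+ 2 <= mean (phi i) ^+ 2.
    rewrite -[leRHS]real_normK ?num_real //; apply: lerXn2r => //.
      by rewrite nnegrE ltW.
    by rewrite nnegrE normr_ge0.
  have d2 : 0 < delta ^+ 2 by apply: exprn_gt0.
  move: (mean (phi i) ^+ 2) b2 => q b2; have q0 := lt_le_trans d2 b2.
  by apply: ler_wpM2l => //; rewrite lef_pV2 ?posrE ?mulr_gt0 // ler_pM2l.
pose hs i := projT1 (cid (H i)).
have hsP i := projT2 (cid (H i)).
exists (fun i x => dsgn (dsgn (mean (phi i)) *
  \sum_(h <- hs i) phi i (x + h) * phi i x)); split.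
- have C := combo_shifts P (fun i => dsgn_sqr (mean (phi i)))
    (fun i => (hsP i).1).
  by apply: (combo_ext (combo_dsgn 0 C)) => i x; rewrite add0r.
- by move=> i x; apply: dsgn_sqr.
- by move=> i; apply: (hsP i).2.
Qed.

(* phi is recovered from the average over the cubes at x of its approximation
   psi. That average is almost everywhere continuous, and since phi takes only
   the values 1 and -1, rounding turns approximation into almost everywhere
   equality with one fixed combination. *)
Lemma biased_structure d V (phi : forall i, V i -> R) :
  fiber_cont R U d -> (forall i, phase d.+1 (phi i)) ->
  ~ tends0 U (fun i => mean (phi i)) ->
  exists2 g, combo (@dyadic R) d g &
    tends0 U (fun i => mean (fun x => `|phi i x - g i x|)).
Proof.
move=> FC P /(not_tends0 UU)[delta d0 bias].
(* Cubes of dimension [d + 2] reproduce a phase of degree [d + 1]. The tolerance [2^-1 / 2 ^ k]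
   becomes 1/2 after the loss of [2 ^ k] in [punctured_dist]. *)
pose k := d.+2; have k0 : 0 < 2 ^+ k :> R by apply: exprn_gt0.
have e0 : 0 < 2^-1 / 2 ^+ k :> R by rewrite divr_gt0 ?invr_gt0 ?ltr0n.
have [psi [Cpsi psi1 phipsi]] := biased_approx P d0 e0.
pose F i x := mean (fun w : cube (V i) k => punctured (psi i) x w).
have CF : ae_cont U d F := fiber_cont_combo UU FC (combo_punctured k Cpsi).
have phiF i x : delta <= `|mean (phi i)| -> `|phi i x - F i x| <= 2^-1.
  move=> hi; have -> : phi i x =
      mean (fun w : cube (V i) k => punctured (phi i) x w).
    rewrite -[LHS](mean_cst (cube (V i) k)); apply: eq_mean => w.
    by rewrite punctured_phase.
  rewrite /F -meanB; apply: le_trans (ler_norm_mean _) _.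
  apply: le_trans (punctured_dist _ _ (P i).1 (psi1 i)) _.
  apply: le_trans (ler_wpM2l (ltW k0) (phipsi i hi)) _.
  by rewrite mulrCA divff ?mulr1 // gt_eqF.
(* Now [g] is within [3/4 + e] of [phi]. Rounding fails only where [e >= 1/4], and its error 2 is
   then at most [8 * e]. *)
have q0 : 0 < 4^-1 :> R by rewrite invr_gt0 ltr0n.
have [g [e [Cg [e_ge0 ne] Fg]]] := CF _ q0.
exists (fun i x => dsgn (0 + g i x)); first exact: combo_dsgn Cg.
apply: (tends0_le UU (b := fun i => 8 * mean (e i))); last exact: tends0Z.
apply: filterS bias => i hi; rewrite ger0_norm; last exact: mean_ge0.
rewrite -meanZ; apply: le_mean => x.
have := le_trans (ler_normD (phi i x - F i x) (F i x - g i x))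
  (lerD (phiF i x hi) (Fg i x)).
rewrite addrA subrK add0r /dsgn; have := e_ge0 i x.
case: (sign_cases ((P i).1 x)) => -> ex;
  case: ifP => [gx|/negbT]; rewrite -?ltNge.
- by move=> _; rewrite subrr normr0; lra.
- by move=> gx; rewrite ger0_norm ?opprK ?ger0_norm; lra.
- by rewrite ler0_norm ?ler0_norm; lra.
- by move=> _ _; rewrite subrr normr0; lra.
Qed.

Lemma fiber_cont0 : fiber_cont R U 0.
Proof.
move=> V Y P PP.
apply: (combo_ae_cont UU (K := xpredT)).
apply: (combo_ext (combo_phase (phi := fun i x => P i (x, 0))
  (c := 1) isT _)) => i.
  exact: (phase_comp (affine_pairl (V i) (0 : Y i)) (PP i)).
move=> x; rewrite mul1r -[LHS](mean_cst (Y i)); apply: eq_mean => y.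
exact: (PP i).2.
Qed.

(* Either P (x, y) P (x, y0) is biased for a suitable choice of y0, and the
   structure theorem lowers the degree; or E_x (E_y P (x, y))^2, which is at
   most the largest of these biases over y0, tends to 0. *)
Lemma fiber_contS d : fiber_cont R U d -> fiber_cont R U d.+1.
Proof.
move=> FC V Y P PP.
have [[y0 bias]|nobias] := pselect (exists y0 : forall i, Y i,
    ~ tends0 U (fun i => mean (fun p => P i p * P i (p.1, y0 i)))).
  pose Q i x := P i (x, y0 i).
  have PQ i : phase d.+1 (Q i).
    exact: (phase_comp (affine_pairl (V i) (y0 i)) (PP i)).
  have PPQ i : phase d.+1 (fun p => P i p * Q i p.1).
    exact: phaseM (PP i) (phase_comp (affine_fst (V i) (Y i)) (PQ i)).
  have [g Cg ng] := biased_structure FC PPQ bias.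
  pose W i : finZmodType := (V i * Y i)%type.
  have ne : null (V := W) U (fun i p => `|P i p * Q i p.1 - g i p|) by split.
  have CG := fiber_cont_combo UU FC Cg.
  have CPQ : ae_cont U d (fun i x => mean (fun y => P i (x, y) * Q i x)).
    apply: ae_cont_null CG (null_mean ne) _ => // i x /=.
    by rewrite -meanB; apply: ler_norm_mean.
  (* As [Q] is a sign, multiplying the average of [P * Q] by [Q] gives back the average of [P]. *)
  apply: (ae_cont_ext (ae_cont_phaseM PQ (ae_contS CPQ))) => i x.
  by rewrite -meanZ; apply: eq_mean => y; rewrite mulrC -mulrA (PQ i).1 mulr1.
apply: tends0_sqr_ae_cont => //.
pose b i y' := mean (fun p => P i p * P i (p.1, y')).
(* The mean of [b i] over [y'] is [E_x (E_y P (x, y)) ^ 2]. *)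
have ex i : exists y', mean (b i) <= b i y'.
  have [y' hy] := exists_le_mean (fun y' => - b i y').
  exists y'; move: hy; rewrite -(eq_mean (fun x => mulN1r (b i x))) meanZ.
  by rewrite mulN1r lerN2.
pose y0 i := projT1 (cid (ex i)).
have [t0|] := pselect (tends0 U (fun i => b i (y0 i))); last first.
  by move=> nt; case: nobias; exists y0.
apply: (tends0_le UU _ t0); apply: filter_forall => i.
rewrite ger0_norm; last by apply: mean_ge0 => x; rewrite -expr2 sqr_ge0.
apply: le_trans (projT2 (cid (ex i))); apply: eq_ler.
rewrite /b exchange_mean mean_pair; apply: eq_mean => x /=.
rewrite -meanZ exchange_mean; apply: eq_mean => y'.
by rewrite mulrC -meanZ; apply: eq_mean => y; rewrite mulrC.
Qed.

Lemma fiber_contP d : fiber_cont R U d.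
Proof. by elim: d => [|d]; [apply: fiber_cont0 | apply: fiber_contS]. Qed.

(** The terms are finite in number and their coefficients are fixed, so limits pass through the
    sum. *)
Lemma combo_mean_lim d V (f : forall i, V i -> R) :
  (forall phi : forall i, V i -> R, (forall i, phase d (phi i)) ->
    exists2 b, dyadic b & tends0 U (fun i => mean (phi i) - b)) ->
  combo (@dyadic R) d f ->
  exists2 b, dyadic b & tends0 U (fun i => mean (f i) - b).
Proof.
move=> H; elim=> [|c phi {}f Kc P _ [b Db tb]].
  exists 0; first exact: dyadic0.
  by apply: (tends0_ext (tends0_0 UU)) => i; rewrite mean_cst subr0.
have [b' Db' tb'] := H phi P.
exists (c * b' + b); first exact/dyadicD/Db/dyadicM.
apply: (tends0_ext (tends0D UU (tends0Z UU c tb') tb)) => i.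
by rewrite meanD meanZ; ring.
Qed.

Lemma phase_mean_lim d V (phi : forall i, V i -> R) :
  (forall i, phase d (phi i)) ->
  exists2 b, dyadic b & tends0 U (fun i => mean (phi i) - b).
Proof.
elim: d phi => [|d IH] phi P.
  (* In degree 0 each [phi i] is constantly 1 or -1, and the ultrafilter decides between them. *)
  have [h|h] := in_ultra_setVsetC (fun i => phi i 0 = 1) UU.
    exists 1; first exact: dyadic1.
    move=> eta eta0; apply: filterS h => i h.
    rewrite (eq_mean (g := fun _ => 1)) ?mean_cst ?subrr ?normr0 ?ltW // => x.
    by rewrite -h; apply: (P i).2.
  exists (-1); first exact: dyadicN1.
  move=> eta eta0; apply: filterS h => i h.
  rewrite (eq_mean (g := fun _ => -1)) ?mean_cst ?subrr ?normr0 ?ltW // => x.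
  by case: (sign_cases ((P i).1 0)) => // <-; apply: (P i).2.
have [t0|bias] := pselect (tends0 U (fun i => mean (phi i))).
  by exists 0; [apply: dyadic0 | apply: (tends0_ext t0) => i; rewrite subr0].
have [g Cg ng] := biased_structure (@fiber_contP d) P bias.
have [b Db tb] := combo_mean_lim IH Cg.
exists b => //; suff t : tends0 U (fun i => mean (phi i) - mean (g i)).
  by apply: (tends0_ext (tends0D UU t tb)) => i; rewrite addrA subrK.
apply: (tends0_le UU _ ng); apply: filter_forall => i.
by rewrite -meanB; apply: ler_norm_mean.
Qed.

End Structure.

(** * Degree through iterated differences *)

Section Polynomial.
Variables (V : finZmodType) (A : comNzRingType).
Implicit Types f g : V -> A.

Fixpoint add_deg d f : Prop :=
  if d is d'.+1 then forall h, add_deg d' (fun x => f (x + h) - f x)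
  else forall x y, f x = f y.

Lemma add_degS d f : add_deg d f -> add_deg d.+1 f.
Proof.
elim: d f => [|d IH] f D h; last exact/IH/D.
by move=> x y; rewrite (D (x + h) (y + h)) (D x y).
Qed.

Lemma add_deg_leq d d' f : (d <= d')%N -> add_deg d f -> add_deg d' f.
Proof.
by move=> /subnK <- D; elim: (d' - d)%N => // k IH; apply: add_degS.
Qed.

Lemma add_deg_cst d a : add_deg d (fun _ => a).
Proof. by elim: d => // d; apply: add_degS. Qed.

Lemma add_degD d f g : add_deg d f -> add_deg d g ->
  add_deg d (fun x => f x + g x).
Proof.
elim: d f g => [|d IH] f g D E; first by move=> x y; rewrite (D x y) (E x y).
move=> h; have := IH _ _ (D h) (E h).
by congr add_deg; apply/funext => x; rewrite opprD addrACA.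
Qed.

Lemma add_deg_shift d f h : add_deg d f -> add_deg d (fun x => f (x + h)).
Proof.
elim: d f => [|d IH] f D; first by move=> x y; apply: D.
move=> k; have := IH _ (D k).
by congr add_deg; apply/funext => x; rewrite addrAC.
Qed.

Lemma add_degZ d a f : add_deg d f -> add_deg d (fun x => a * f x).
Proof.
elim: d f => [|d IH] f D; first by move=> x y; rewrite (D x y).
move=> h; have := IH _ (D h).
by congr add_deg; apply/funext => x; rewrite mulrBr.
Qed.

(** Induction on [a + b] by the Leibniz rule: the difference of [f * g] is that of [f] times
    [g (x + h)], plus [f] times that of [g]. *)
Lemma add_degM a b f g : add_deg a f -> add_deg b g ->
  add_deg (a + b) (fun x => f x * g x).
Proof.
have cst c f0 g0 : add_deg 0 f0 -> add_deg c g0 ->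
    add_deg c (fun x => f0 x * g0 x).
  move=> D E; rewrite (_ : (fun x => _) = fun x => f0 0 * g0 x).
    exact: add_degZ.
  by apply/funext => x; rewrite (D x 0).
have [n] := ubnP (a + b); elim: n a b f g => // n IH [|a] [|b] f g ab D E.
- exact: cst.
- exact: cst.
- rewrite addn0 (_ : (fun x => _) = fun x => g x * f x); first exact: cst.
  by apply/funext => x; rewrite mulrC.
move=> h.
have h1 : add_deg (a + b.+1) (fun x => (f (x + h) - f x) * g (x + h)).
  by apply: (IH a b.+1 _ _ ab (D h)); apply: add_deg_shift E.
have h2 : add_deg (a + b.+1) (fun x => f x * (g (x + h) - g x)).
  have := IH a.+1 b f _ _ D (E h); rewrite addSnnS; exact.
have := add_degD h1 h2.
by congr add_deg; apply/funext => x; ring.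
Qed.

Lemma add_degX k f : add_deg 1 f -> add_deg k (fun x => f x ^+ k).
Proof.
move=> D; elim: k => [|k IH]; first by move=> x y; rewrite !expr0.
by have := add_degM D IH; congr add_deg; apply/funext => x; rewrite exprS.
Qed.

End Polynomial.

Lemma add_deg_sum (V : finZmodType) (A : comNzRingType) (T : eqType) d
    (r : seq T) (F : T -> V -> A) :
  (forall t, t \in r -> add_deg d (F t)) ->
  add_deg d (fun x => \sum_(t <- r) F t x).
Proof.
elim: r => [|t r IH] H.
  rewrite (_ : (fun x => _) = fun=> 0); first exact: add_deg_cst.
  by apply/funext => x; rewrite big_nil.
rewrite (_ : (fun x => _) = fun x => F t x + \sum_(s <- r) F s x); last first.
  by apply/funext => x; rewrite big_cons.
apply: add_degD; first by apply: H; rewrite mem_head.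
by apply: IH => s rs; apply: H; rewrite in_cons rs orbT.
Qed.

Lemma add_deg_prod (V : finZmodType) (A : comNzRingType) (T : Type)
    (r : seq T) (d : T -> nat) (F : T -> V -> A) :
  (forall t, add_deg (d t) (F t)) ->
  add_deg (\sum_(t <- r) d t) (fun x => \prod_(t <- r) F t x).
Proof.
move=> H; elim: r => [|t r IH].
  rewrite (_ : (fun x => _) = fun=> 1); first exact: add_deg_cst.
  by apply/funext => x; rewrite big_nil.
rewrite big_cons; have := add_degM (H t) IH.
by congr add_deg; apply/funext => x; rewrite big_cons.
Qed.

(** Coordinates have constant differences, hence degree 1, so a monomial has degree at most its
    total degree. *)
Lemma poly_deg_le_add_deg n d (P : 'rV['F_2]_n -> 'F_2) :
  poly_deg_le d P -> add_deg d P.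
Proof.
move=> [p [szp pP]].
have -> : P = fun x => \sum_(m <- msupp p) p@_m * \prod_i x ord0 i ^+ m i.
  by apply/funext => x; rewrite -pP mevalE.
apply: add_deg_sum => m mp; apply: add_degZ.
apply: (@add_deg_leq _ _ (mdeg m)).
  by rewrite -ltnS (leq_trans (msize_mdeg_lt mp)).
rewrite mdegE; apply: add_deg_prod => i; apply: add_degX => h x y.
by rewrite !mxE addrAC subrr add0r addrAC subrr add0r.
Qed.

(** * Signs of F_2-valued functions and total variation *)

Section Sign.
Variable R : realType.

Definition F2sign (a : 'F_2) : R := if a == 1 then -1 else 1.

Lemma F2signB a b : F2sign (a - b) = F2sign a * F2sign b.
Proof.
rewrite /F2sign; case: a b => [[|[|//]] ha] [[|[|//]] hb];
  by rewrite /= ?mulrNN ?mulr1 ?mul1r.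
Qed.

Lemma phase_F2sign (V : finZmodType) d (P : V -> 'F_2) :
  add_deg d P -> phase d (fun x => F2sign (P x)).
Proof.
move=> D; split=> [x|].
  by rewrite /F2sign; case: eqP => _; rewrite ?mulrNN mulr1.
elim: d P D => [|d IH] P D; first by move=> x y; rewrite (D x y).
move=> h; have := IH _ (D h).
by congr deriv_deg; apply/funext => x; rewrite F2signB.
Qed.

Lemma mean_F2sign n (P : 'rV['F_2]_n -> 'F_2) :
  mean (fun x => F2sign (P x)) = 1 - 2 * law_unif R P 1.
Proof.
have -> : mean (fun x => F2sign (P x)) =
          mean (fun x => 1 - 2 * (P x == 1)%:R : R).
  apply: eq_mean => x; rewrite /F2sign; case: eqP => _ /=; ring.
rewrite meanB mean_cst meanZ; congr (_ - _ * _).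
rewrite /mean /law_unif mulrC card_mx card_Fp // mul1n natrX.
congr (_ / _); rewrite -natr_sum; congr (_%:R).
by rewrite -sum1dep_card [RHS]big_mkcond; apply: eq_bigr => x _; case: eqP.
Qed.

(** The left side is twice the discrepancy at the value 1, of which half already enters the total
    variation distance. *)
Lemma tv_dist_mean n (P : 'rV['F_2]_n -> 'F_2) (rho : R) :
  `|mean (fun x => F2sign (P x)) - (1 - 2 * rho)| <=
  4 * tv_dist (law_unif R P) (bernoulli_F2 rho).
Proof.
rewrite mean_F2sign /tv_dist (bigD1 (1 : 'F_2)) //= /bernoulli_F2 eqxx.
set s := \sum_(_ | _) _; have s0 : 0 <= s by apply: sumr_ge0.
rewrite (_ : _ - _ = (- 2) * (law_unif R P 1 - rho)); last by ring.
rewrite normrM normrN normr_nat.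
have := normr_ge0 (law_unif R P 1 - rho); lra.
Qed.

End Sign.

(** * From a sequence of counterexamples to a dyadic limit *)

Theorem theoremA8 (R : realType) (rho : R) (d : nat) :
  0 < rho -> rho < 1 -> ~ dyadic rho -> (0 < d)%N ->
  exists c : R, 0 < c /\
    forall (n : nat) (P : 'rV['F_2]_n -> 'F_2),
      poly_deg_le d P ->
      c <= tv_dist (law_unif R P) (bernoulli_F2 rho).
Proof.
move=> _ _ ndy _; apply: contrapT => noc; apply: ndy.
(* Each constant [1 / (m + 1)] fails for some polynomial, in a number of variables that may vary
   with [m]. *)
have H m : exists n, exists P : 'rV['F_2]_n -> 'F_2, poly_deg_le d P /\
    tv_dist (law_unif R P) (bernoulli_F2 rho) < m.+1%:R^-1.
  apply: contrapT => /forallNP nH; apply: noc; exists m.+1%:R^-1.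
  split=> [|n P dP]; first by rewrite invr_gt0 ltr0n.
  rewrite leNgt; apply/negP => lt; apply: (nH n); by exists P.
pose n m := projT1 (cid (H m)).
pose P m := projT1 (cid (projT2 (cid (H m)))) : 'rV['F_2]_(n m) -> 'F_2.
have PP m : poly_deg_le d (P m) /\
    tv_dist (law_unif R (P m)) (bernoulli_F2 rho) < m.+1%:R^-1.
  exact: projT2 (cid (projT2 (cid (H m)))).
(* [U] contains every set that holds for all large [m], so ordinary limits are limits along [U]. *)
have [U [UU leU]] := ultraFilterLemma eventually_filter.
pose V m : finZmodType := 'rV['F_2]_(n m).
have phP m : phase d (fun x : V m => F2sign R (P m x)).
  by apply: phase_F2sign; apply: poly_deg_le_add_deg (PP m).1.
have [b [a [k bE]] lim_b] := phase_mean_lim UU phP.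
have b_rho : b = 1 - 2 * rho.
  apply/eqP; rewrite -subr_eq0 -normr_le0; apply/ler_addgt0Pr => eps eps0.
  rewrite add0r; have e2 : 0 < eps / 2 by rewrite divr_gt0.
  have [m [hm hb]] : exists m, 4 * m.+1%:R^-1 <= eps / 2 /\
      `|mean (fun x : V m => F2sign R (P m x)) - b| <= eps / 2.
    have ev : U (fun m => 4 * m.+1%:R^-1 <= eps / 2).
      apply: leU; exists (Num.bound (8 / eps)) => // m /= hm.
      rewrite ler_pdivrMr ?ltr0n //.
      have := archi_boundP (ltW (divr_gt0 (ltr0n R 8) eps0)).
      rewrite ltr_pdivrMr // => h.
      have : (Num.bound (8 / eps))%:R <= m.+1%:R :> R by rewrite ler_nat leqW.
      nra.
    have [m hm] := filter_ex (filterI ev (lim_b _ e2)).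
    by exists m.
  have ht := tv_dist_mean (P m) rho.
  rewrite distrC in hb.
  rewrite -(subrKA (mean (fun x : V m => F2sign R (P m x)))).
  apply: le_trans (ler_normD _ _) _.
  by move: hb ht hm (PP m).2; move: m.+1%:R^-1 => q; lra.
(* With [b = a / 2 ^ k], this is the fraction [(1 - b) / 2]. *)
exists (2 ^+ k - a), k.+1.
have -> : rho = (1 - b) / 2 by rewrite b_rho; field.
rewrite bE intrB rmorphXn /= exprS; field.
by rewrite pow2_unit.
Qed.
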